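(* Let $\widehat\Sigma\in\mathbb{R}^{n\times n}$ be symmetric strictly positive definite and let $n_2,k$ be integers with $n_2\le k<n$, $n_1=n-n_2$. Partition $\widehat\Sigma=\begin{pmatrix}\widehat\Sigma_{11}&\widehat\Sigma_{12}\\ \widehat\Sigma_{21}&\widehat\Sigma_{22}\end{pmatrix}$ with $\widehat\Sigma_{ii}$ of size $n_i\times n_i$ and put $\widetilde\Sigma_{11}=\widehat\Sigma_{11}-\widehat\Sigma_{12}\widehat\Sigma_{22}^{-1}\widehat\Sigma_{21}$. Consider the problem of minimizing $\mathcal I(\widehat\Sigma\|HH^\top+D)$ over $H\in\mathbb{R}^{n\times k}$ and $D$ of the form $$D=\begin{pmatrix}D_1&0\\0&0\end{pmatrix},\qquad D_1\in\mathbb{R}^{n_1\times n_1}\ \text{diagonal},\ D_1>0.$$ Any pair $(H,D)$ solving this problem, with $D=\begin{pmatrix}D_1&0\\0&0\end{pmatrix}$, where $D_1\in\mathbb{R}^{n_1\times n_1}$ is diagonal and $D_1>0$, and $$H=\begin{pmatrix}H_{11}&H_{12}\\0&H_{22}\end{pmatrix},\qquad H_{11}\in\mathbb{R}^{n_1\times(k-n_2)},\ H_{12}\in\mathbb{R}^{n_1\times n_2},\ H_{22}\in\mathbb{R}^{n_2\times n_2}\text{ invertible},$$ satisfies: - $\mathcal I(\widetilde\Sigma_{11}\|H_{11}H_{11}^\top+D_1)$ is minimized (over all $H_{11}\in\mathbb{R}^{n_1\times(k-n_2)}$ and all diagonal $D_1>0$ of size $n_1\times n_1$); - $H_{22}H_{22}^\top=\widehat\Sigma_{22}$;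 - $H_{12}=\widehat\Sigma_{12}\widehat\Sigma_{22}^{-1}H_{22}$.
   Context: For strictly positive definite $m\times m$ matrices, $\mathcal I(\Sigma_1\|\Sigma_2)=\frac12\log\frac{|\Sigma_2|}{|\Sigma_1|}-\frac m2+\frac12\mathrm{tr}(\Sigma_2^{-1}\Sigma_1)$ is the I-divergence between $N(0,\Sigma_1)$ and $N(0,\Sigma_2)$; it is $+\infty$ when $\Sigma_1>0$ and $\Sigma_2$ is singular. *)

(* Defs.v *)
From HB Require Import structures.
From mathcomp Require Import all_boot all_order all_algebra.
From mathcomp Require Import reals constructive_ereal exp.

Set Implicit Arguments.
Unset Strict Implicit.
Unset Printing Implicit Defensive.

Import Order.TTheory GRing.Theory Num.Theory.
Local Open Scope ring_scope.

Definition posdefmx (R : realType) (m : nat) (A : 'M[R]_m) : Prop :=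
  A^T = A /\ forall x : 'cV[R]_m, x != 0 -> 0 < (x^T *m A *m x) ord0 ord0.

(* I-divergence between the centered Gaussians N(0, S1) and N(0, S2). It is
   meaningful only for S1 positive definite and S2 positive semidefinite, the
   second branch being then the case of a singular S2. *)
Definition Idiv (R : realType) (m : nat) (S1 S2 : 'M[R]_m) : \bar R :=
  if S2 \in unitmx then
    (2^-1 * ln (\det S2 / \det S1) - m%:R / 2
       + 2^-1 * \tr (invmx S2 *m S1))%:E
  else +oo%E.

Definition posdiagmx (R : realType) (m : nat) (D : 'M[R]_m) : Prop :=
  is_diag_mx D /\ posdefmx D.

(* (H, D) minimizes Idiv S (H H^T + D) over all n x k matrices H and all n x n
   matrices D satisfying the constraint C. *)
Definition FA_solution (R : realType) (n k : nat) (S : 'M[R]_n)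
    (C : 'M[R]_n -> Prop) (H : 'M[R]_(n, k)) (D : 'M[R]_n) : Prop :=
  C D /\ forall (H' : 'M[R]_(n, k)) (D' : 'M[R]_n), C D' ->
    (Idiv S (H *m H^T + D) <= Idiv S (H' *m H'^T + D'))%E.

Definition singular_noise (R : realType) (n1 n2 : nat)
    (D : 'M[R]_(n1 + n2)) : Prop :=
  exists D1 : 'M[R]_n1, posdiagmx D1 /\ D = block_mx D1 0 0 0.

Definition schur_compl (R : realType) (n1 n2 : nat)
    (S : 'M[R]_(n1 + n2)) : 'M[R]_n1 :=
  ulsubmx S - ursubmx S *m invmx (drsubmx S) *m dlsubmx S.

(* Main.v *)
Require Import Defs.
From HB Require Import structures.
From mathcomp Require Import all_boot all_order all_algebra.
From mathcomp Require Import reals constructive_ereal exp.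
From mathcomp Require Import ring lra.

Import Order.TTheory GRing.Theory Num.Theory.
Local Open Scope ring_scope.

Set Implicit Arguments.
Unset Strict Implicit.
Unset Printing Implicit Defensive.

(** Write a model covariance H H^T + D as the covariance of a pair (Y1, Y2):
    since the noise on Y2 vanishes and H22 is invertible, Y2 has covariance
    P = H22 H22^T, and Y1 regresses on Y2 with coefficient L = H12 H22^-1 and
    residual covariance A = H11 H11^T + D1.  The data covariance S splits in
    the same way, with covariance S22, coefficient K = S12 S22^-1 and residual
    covariance the Schur complement B.  Both splittings are the block
    factorization [udu], and in these coordinates the divergence decouples
    ([Idiv_real_udu], the chain rule for the divergence of a joint law):

      I(S || H H^T + D) =
        I(B || A) + I(S22 || P) + 1/2 tr (A^-1 (K - L) S22 (K - L)^T).

    The last two terms are nonnegative, and vanish exactly when P = S22 and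
    L = K ([Idiv_real_ge0_eq0], [mxtrace_posdef_ge0_eq0]).  They can be made to
    vanish with any prescribed (H11, D1), because S22 has a square root.  So a
    minimizer has both terms equal to zero, which is the form of H22 and H12,
    and minimizes the first term, which is the optimality of (H11, D1).

    The only inequality behind this is ln det Y <= tr Y - m for Y positive
    definite, with equality only at the identity ([lndet_le_trace_eq]).  A
    Cholesky factor T of Y reduces it to the scalar ln x <= x - 1: det Y is
    the product of the squared diagonal entries of T, while tr Y is the sum of
    the squares of all its entries. *)

(** * Positive definite matrices *)

Lemma mxtrace_mul_tr (R : comPzRingType) (m p : nat) (X : 'M[R]_(m, p)) :
  \tr (X *m X^T) = \sum_i \sum_j X i j ^+ 2.
Proof.
by apply: eq_bigr => i _; rewrite mxE; apply: eq_bigr => j _; rewrite mxE.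
Qed.

Lemma mxtrace_mul_tr_ge0 (R : realDomainType) (m p : nat) (X : 'M[R]_(m, p)) :
  0 <= \tr (X *m X^T).
Proof.
by rewrite mxtrace_mul_tr; do 2!apply: sumr_ge0 => ? _; exact: sqr_ge0.
Qed.

Lemma mxtrace_mul_tr_eq0 (R : realDomainType) (m p : nat) (X : 'M[R]_(m, p)) :
  \tr (X *m X^T) = 0 -> X = 0.
Proof.
rewrite mxtrace_mul_tr => /eqP.
rewrite psumr_eq0 => [/allP X0 | i _]; last first.
  by apply: sumr_ge0 => j _; exact: sqr_ge0.
apply/matrixP => i j; rewrite mxE; apply/eqP.
have := X0 i (mem_index_enum i); rewrite psumr_eq0 => [/allP Xi0 | ? _].
  by have := Xi0 j (mem_index_enum j); rewrite sqrf_eq0.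
exact: sqr_ge0.
Qed.

Lemma invmxM (R : comUnitRingType) (m : nat) (A B : 'M[R]_m) :
  A \in unitmx -> B \in unitmx -> invmx (A *m B) = invmx B *m invmx A.
Proof.
move=> Au Bu; have ABu : A *m B \in unitmx by rewrite unitmx_mul Au.
apply: (can_inj (mulKmx ABu)).
by rewrite mulmxV // -mulmxA mulKVmx // mulmxV.
Qed.

Lemma posdefmx1 (R : realType) (m : nat) : posdefmx (1%:M : 'M[R]_m).
Proof.
split=> [|x x0]; first exact: trmx1.
rewrite mulmx1 -trace_mx11 -{2}[x]trmxK lt_def mxtrace_mul_tr_ge0 andbT.
apply: contra_neq x0 => /mxtrace_mul_tr_eq0 /(congr1 trmx).
by rewrite trmxK trmx0.
Qed.

(** For V square and invertible this is invariance under congruence; coordinate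
    projections V give the principal blocks. *)
Lemma posdefmx_congr (R : realType) (m p : nat) (V : 'M[R]_(p, m))
    (A : 'M[R]_m) :
  row_free V -> posdefmx A -> posdefmx (V *m A *m V^T).
Proof.
move=> Vfree [Asym Apos]; split=> [|x x0].
  by rewrite !trmx_mul trmxK Asym mulmxA.
have -> : x^T *m (V *m A *m V^T) *m x = (V^T *m x)^T *m A *m (V^T *m x).
  by rewrite trmx_mul trmxK !mulmxA.
apply: Apos; rewrite -(inj_eq trmx_inj) trmx_mul trmxK trmx0 mulmx_free_eq0 //.
by rewrite -(inj_eq trmx_inj) trmxK trmx0.
Qed.

Lemma posdefmx_ulsubmx (R : realType) (m p : nat) (A : 'M[R]_(m + p)) :
  posdefmx A -> posdefmx (ulsubmx A).
Proof.
have -> : ulsubmx A = row_mx 1%:M 0 *m A *m (row_mx 1%:M 0)^T.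
  rewrite -{2}[A]submxK tr_row_mx mul_row_block mul_row_col trmx1 trmx0.
  by rewrite !mul1mx !mul0mx !addr0 mulmx1 mulmx0 addr0.
apply: posdefmx_congr; apply/row_freeP; exists (col_mx 1%:M 0).
by rewrite mul_row_col mul1mx mul0mx addr0.
Qed.

Lemma posdefmx_drsubmx (R : realType) (m p : nat) (A : 'M[R]_(m + p)) :
  posdefmx A -> posdefmx (drsubmx A).
Proof.
have -> : drsubmx A = row_mx 0 1%:M *m A *m (row_mx 0 1%:M)^T.
  rewrite -{2}[A]submxK tr_row_mx mul_row_block mul_row_col trmx1 trmx0.
  by rewrite !mul1mx !mul0mx !add0r mulmx1 mulmx0 add0r.
apply: posdefmx_congr; apply/row_freeP; exists (col_mx 0 1%:M).
by rewrite mul_row_col mul1mx mul0mx add0r.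
Qed.

Lemma posdefmx_unit (R : realType) (m : nat) (A : 'M[R]_m) :
  posdefmx A -> A \in unitmx.
Proof.
case=> _ Apos; rewrite unitmxE unitfE; apply/det0P => -[v v0 vA].
have := Apos v^T; rewrite trmxK vA mul0mx mxE ltxx.
by rewrite -(inj_eq trmx_inj) trmxK trmx0 => /(_ v0).
Qed.

Lemma posdefmx_gramD (R : realType) (m p : nat) (H : 'M[R]_(m, p))
    (A : 'M[R]_m) :
  posdefmx A -> posdefmx (H *m H^T + A).
Proof.
case=> Asym Apos; split=> [|x x0].
  by rewrite linearD /= trmx_mul trmxK Asym.
rewrite mulmxDr mulmxDl mxE ltr_wpDl ?Apos //.
have -> : x^T *m (H *m H^T) *m x = (x^T *m H) *m (x^T *m H)^T.
  by rewrite trmx_mul trmxK !mulmxA.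
by rewrite -trace_mx11 mxtrace_mul_tr_ge0.
Qed.

(** * Block triangular factorization and Cholesky *)

(** The change of variables (y1, y2) -> (y1 + L y2, y2). *)
Definition shear (R : comUnitRingType) (m p : nat) (L : 'M[R]_(m, p)) :
    'M[R]_(m + p) :=
  block_mx 1%:M L 0 1%:M.

(** The covariance of (u + L v, v) when u and v are uncorrelated with
    covariances A and P. *)
Definition udu (R : comUnitRingType) (m p : nat) (L : 'M[R]_(m, p))
    (A : 'M[R]_m) (P : 'M[R]_p) : 'M[R]_(m + p) :=
  shear L *m block_mx A 0 0 P *m (shear L)^T.

Lemma shearM (R : comUnitRingType) (m p : nat) (K L : 'M[R]_(m, p)) :
  shear K *m shear L = shear (K + L).
Proof.
rewrite mulmx_block !mul1mx !mulmx1 !mulmx0 !mul0mx !addr0 add0r.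
by rewrite [L + K]addrC.
Qed.

Lemma shear0 (R : comUnitRingType) (m p : nat) :
  shear (0 : 'M[R]_(m, p)) = 1%:M.
Proof. by rewrite /shear -scalar_mx_block. Qed.

Lemma det_shear (R : comUnitRingType) (m p : nat) (L : 'M[R]_(m, p)) :
  \det (shear L) = 1.
Proof. by rewrite det_ublock !det1 mulr1. Qed.

Lemma shear_unit (R : comUnitRingType) (m p : nat) (L : 'M[R]_(m, p)) :
  shear L \in unitmx.
Proof. by rewrite unitmxE det_shear unitr1. Qed.

Lemma uduE (R : comUnitRingType) (m p : nat) (L : 'M[R]_(m, p))
    (A : 'M[R]_m) (P : 'M[R]_p) :
  udu L A P = block_mx (A + L *m P *m L^T) (L *m P) (P *m L^T) P.
Proof.
rewrite /udu /shear tr_block_mx !mulmx_block !trmx1 !trmx0.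
by rewrite !mul1mx !mulmx1 !mulmx0 !mul0mx !addr0 !add0r.
Qed.

Lemma det_udu (R : comUnitRingType) (m p : nat) (L : 'M[R]_(m, p))
    (A : 'M[R]_m) (P : 'M[R]_p) :
  \det (udu L A P) = \det A * \det P.
Proof. by rewrite !det_mulmx det_tr det_shear mul1r mulr1 det_ublock. Qed.

(** The regression of the first block on the second one leaves a residual
    whose covariance is the Schur complement. *)
Lemma schur_udu (R : realType) (m p : nat) (S : 'M[R]_(m + p)) :
  posdefmx S ->
  S = udu (ursubmx S *m invmx (drsubmx S)) (schur_compl S) (drsubmx S).
Proof.
move=> Spd; have S22u := posdefmx_unit (posdefmx_drsubmx Spd).
have [S22sym _] := posdefmx_drsubmx Spd.
have S21 : (ursubmx S)^T = dlsubmx S by rewrite trmx_ursub (proj1 Spd).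
rewrite uduE trmx_mul trmx_inv S22sym S21 !mulmxA mulmxV // mul1mx !mulmxKV //.
by rewrite /schur_compl subrK submxK.
Qed.

(** Undoing the regression is a congruence that makes the Schur complement a
    principal block. *)
Lemma posdefmx_schur (R : realType) (m p : nat) (S : 'M[R]_(m + p)) :
  posdefmx S -> posdefmx (schur_compl S).
Proof.
move=> Spd; have Sf := schur_udu Spd.
set K := ursubmx S *m _ in Sf.
have : posdefmx (shear (- K) *m S *m (shear (- K))^T).
  by apply: posdefmx_congr => //; rewrite row_free_unit shear_unit.
rewrite [X in _ *m X *m _]Sf /udu !mulmxA shearM -mulmxA -trmx_mul shearM.
rewrite addNr shear0 trmx1 mulmx1 mul1mx => /posdefmx_ulsubmx.
by rewrite block_mxKul.
Qed.

(** Induction on the size, splitting off the first coordinate: its residual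
    variance given the others is a positive scalar, whose square root is the new
    pivot.  Splitting off the first coordinate, rather than the last, puts the
    transposed factor on the left. *)
Lemma posdefmx_cholesky (R : realType) (m : nat) (A : 'M[R]_m) :
  posdefmx A -> exists2 T : 'M[R]_m, is_trig_mx T & A = T^T *m T.
Proof.
elim: m A => [|m IHm] A Apd.
  by exists 0; [rewrite mx0_is_trig | apply/matrixP => -[]].
rewrite -[m.+1]/(1 + m)%N in A Apd *.
have [T Ttrig AT] := IHm _ (posdefmx_drsubmx Apd).
have := posdefmx_schur Apd; have := schur_udu Apd.
move: (_ *m invmx _) (schur_compl A) => L s Af [_ spos].
have s_gt0 : 0 < s 0 0.
  have := spos 1%:M; rewrite trmx1 mul1mx mulmx1; apply.
  exact: oner_neq0.
exists (block_mx (Num.sqrt (s 0 0))%:M 0 (T *m L^T) T).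
  by rewrite is_trig_block_mx // eqxx scalar_mx_is_trig.
rewrite Af uduE AT tr_block_mx mulmx_block.
rewrite trmx0 trmx_mul trmxK !mulmx0 !mul0mx !add0r tr_scalar_mx.
rewrite -scalar_mxM -expr2 sqr_sqrtr ?ltW // -mx11_scalar.
by rewrite !mulmxA.
Qed.

Lemma posdefmx_det_gt0 (R : realType) (m : nat) (A : 'M[R]_m) :
  posdefmx A -> 0 < \det A.
Proof.
move=> Apd; have := posdefmx_unit Apd; rewrite unitmxE unitfE.
have [T _ ->] := posdefmx_cholesky Apd.
rewrite det_mulmx det_tr -expr2 => T0.
by rewrite lt_def T0 sqr_ge0.
Qed.

(** * The I-divergence *)

Lemma ln_sub1_gt0 (R : realType) (x : R) : 0 < x -> x != 1 -> 0 < x - 1 - ln x.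
Proof.
move=> x0 x1; have : ln x != 0 by rewrite ln_eq0.
by move=> /expR_gt1Dx; rewrite lnK // => ?; lra.
Qed.

Lemma ln_sub1_ge0 (R : realType) (x : R) : 0 < x -> 0 <= x - 1 - ln x.
Proof.
move=> x0; have [->|x1] := eqVneq x 1; first by rewrite ln1 !subrr.
by rewrite ltW ?ln_sub1_gt0.
Qed.

Lemma ln_prod (R : realType) (I : finType) (F : I -> R) :
  (forall i, 0 < F i) -> ln (\prod_i F i) = \sum_i ln (F i).
Proof.
move=> F0; suff [] : ln (\prod_i F i) = \sum_i ln (F i) /\ 0 < \prod_i F i by [].
elim/big_rec2: _ => [|i y x _ [<- x0]]; first by rewrite ln1.
by rewrite lnM ?posrE ?mulr_gt0.
Qed.

(** With Y = T^T T and T triangular, the difference of the two sides is the sum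
    of t_ii^2 - 1 - ln t_ii^2 over the diagonal and of t_ij^2 off the diagonal.
    If it vanishes, T is diagonal with entries 1 or -1, whence Y = 1. *)
Lemma lndet_le_trace_eq (R : realType) (m : nat) (Y : 'M[R]_m) : posdefmx Y ->
  0 <= \tr Y - m%:R - ln (\det Y)
  /\ (\tr Y - m%:R - ln (\det Y) = 0 -> Y = 1%:M).
Proof.
move=> Ypd; have := posdefmx_det_gt0 Ypd.
have [T Ttrig ->] := posdefmx_cholesky Ypd.
rewrite det_mulmx det_tr mxtrace_mulC mxtrace_mul_tr -expr2 det_trig // -prodrXl.
move=> d0.
have T0 i : 0 < T i i ^+ 2.
  rewrite lt_def sqr_ge0 andbT; apply: contraTneq d0 => Ti.
  by rewrite (bigD1 i) //= Ti mul0r ltxx.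
rewrite ln_prod //.
have -> : \sum_i \sum_j T i j ^+ 2 - m%:R - \sum_i ln (T i i ^+ 2)
  = \sum_i ((T i i ^+ 2 - 1 - ln (T i i ^+ 2))
            + \sum_(j | j != i) T i j ^+ 2).
  rewrite -[m in m%:R]card_ord -sumr_const -!sumrB; apply: eq_bigr => i _.
  by rewrite (bigD1 i) //=; ring.
have off0 i : 0 <= \sum_(j | j != i) T i j ^+ 2.
  by apply: sumr_ge0 => j _; exact: sqr_ge0.
have dia0 i := ln_sub1_ge0 (T0 i).
split; first by apply: sumr_ge0 => i _; rewrite addr_ge0.
move=> /eqP; rewrite psumr_eq0 => [/allP Z|i _]; last by rewrite addr_ge0.
have {}Z i : T i i ^+ 2 = 1 /\ forall j, j != i -> T i j = 0.
  have := Z i (mem_index_enum i); rewrite /= paddr_eq0 // => /andP[Zd Zo].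
  split=> [|j ji].
    by apply: contraTeq Zd => /(ln_sub1_gt0 (T0 i)) /gt_eqF ->.
  move: Zo; rewrite psumr_eq0 => [/allP/(_ j (mem_index_enum j))|? _].
    by rewrite ji /= sqrf_eq0 => /eqP.
  exact: sqr_ge0.
apply/matrixP => i j; rewrite !mxE (bigD1 i) //= big1 => [|k ki].
  rewrite addr0 mxE; have [->|ij] := eqVneq i j.
    by rewrite -expr2 (Z j).1.
  by rewrite [T i j](Z i).2 ?mulr0 // eq_sym.
by rewrite mxE [T k i](Z k).2 ?mul0r // eq_sym.
Qed.

(** The finite branch of [Idiv], as a real number, so that divergences can be
    added and compared by ring arithmetic. *)
Definition Idiv_real (R : realType) (m : nat) (S1 S2 : 'M[R]_m) : R :=
  2^-1 * ln (\det S2 / \det S1) - m%:R / 2 + 2^-1 * \tr (invmx S2 *m S1).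

Lemma Idiv_unitE (R : realType) (m : nat) (S1 S2 : 'M[R]_m) :
  S2 \in unitmx -> Idiv S1 S2 = (Idiv_real S1 S2)%:E.
Proof. by rewrite /Idiv => ->. Qed.

(** Factoring P = Q^T Q and whitening S into Y = Q^-T S Q^-1 turns the
    divergence into (tr Y - m - ln det Y) / 2. *)
Lemma Idiv_real_ge0_eq0 (R : realType) (m : nat) (S P : 'M[R]_m) :
  posdefmx S -> posdefmx P -> 0 <= Idiv_real S P /\ (Idiv_real S P = 0 -> P = S).
Proof.
move=> Spd Ppd; have Pu := posdefmx_unit Ppd.
have S0 := posdefmx_det_gt0 Spd; have P0 := posdefmx_det_gt0 Ppd.
have [Q _ PQ] := posdefmx_cholesky Ppd.
have Qu : Q \in unitmx by move: Pu; rewrite PQ unitmx_mul => /andP[].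
have Qtu : Q^T \in unitmx by rewrite unitmx_tr.
pose V := (invmx Q)^T; pose Y := V *m S *m V^T.
have VE : V = invmx Q^T by rewrite /V trmx_inv.
have Ypd : posdefmx Y.
  by apply: posdefmx_congr => //; rewrite row_free_unit unitmx_tr unitmx_inv.
have YE : \tr Y = \tr (invmx P *m S).
  by rewrite /Y mxtrace_mulC trmxK VE mulmxA PQ invmxM //.
have detY : \det Y = \det S / \det P.
  rewrite /Y !det_mulmx trmxK det_tr det_inv PQ det_mulmx det_tr invfM.
  by rewrite mulrAC mulrC.
have -> : Idiv_real S P = 2^-1 * (\tr Y - m%:R - ln (\det Y)).
  rewrite /Idiv_real -YE detY.
  have -> : ln (\det P / \det S) = - ln (\det S / \det P).
    by rewrite -lnV ?posrE ?divr_gt0 // invf_div.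
  by field.
have [Y0 Y1] := lndet_le_trace_eq Ypd; split; first by rewrite mulr_ge0 ?invr_ge0.
move/eqP; rewrite mulf_eq0 invr_eq0 pnatr_eq0 /= => /eqP /Y1 YI.
have : Q^T *m Y *m Q = S by rewrite /Y trmxK VE !mulmxA mulmxV // mul1mx mulmxKV.
by rewrite YI mulmx1 -PQ.
Qed.

(** With A = T^T T and B = C^T C, the trace is the sum of the squared entries of
    T^-T W C^T, and W is recovered from that matrix. *)
Lemma mxtrace_posdef_ge0_eq0 (R : realType) (m p : nat) (A : 'M[R]_m)
    (B : 'M[R]_p) (W : 'M[R]_(m, p)) : posdefmx A -> posdefmx B ->
  0 <= \tr (invmx A *m (W *m B *m W^T))
  /\ (\tr (invmx A *m (W *m B *m W^T)) = 0 -> W = 0).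
Proof.
move=> Apd Bpd; have := posdefmx_unit Apd; have := posdefmx_unit Bpd.
have [T _ ->] := posdefmx_cholesky Apd; have [C _ ->] := posdefmx_cholesky Bpd.
rewrite !unitmx_mul => /andP[Ctu Cu] /andP[Ttu Tu].
have -> : \tr (invmx (T^T *m T) *m (W *m (C^T *m C) *m W^T))
        = \tr ((invmx T^T *m W *m C^T) *m (invmx T^T *m W *m C^T)^T).
  rewrite invmxM // -mulmxA mxtrace_mulC !trmx_mul trmxK trmx_inv trmxK.
  by rewrite !mulmxA.
split=> [|/mxtrace_mul_tr_eq0 X0]; first exact: mxtrace_mul_tr_ge0.
have <- : T^T *m (invmx T^T *m W *m C^T) *m invmx C^T = W.
  by rewrite !mulmxA mulmxV // mul1mx mulmxK.
by rewrite X0 mulmx0 mul0mx.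
Qed.

(** Chain rule: the determinants of the two shears are 1, so the logarithms
    add up; in the trace, the shear of the model acts on the data and replaces
    its coefficient K by K - L, whose contribution to the first diagonal block
    is the last term. *)
Lemma Idiv_real_udu (R : realType) (m p : nat) (K L : 'M[R]_(m, p))
    (B A : 'M[R]_m) (Q P : 'M[R]_p) :
  posdefmx A -> posdefmx P -> posdefmx B -> posdefmx Q ->
  Idiv_real (udu K B Q) (udu L A P)
  = Idiv_real B A + Idiv_real Q P
    + 2^-1 * \tr (invmx A *m ((K - L) *m Q *m (K - L)^T)).
Proof.
move=> Apd Ppd Bpd Qpd.
have Au := posdefmx_unit Apd; have Pu := posdefmx_unit Ppd.
have A0 := posdefmx_det_gt0 Apd; have P0 := posdefmx_det_gt0 Ppd.
have B0 := posdefmx_det_gt0 Bpd; have Q0 := posdefmx_det_gt0 Qpd.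
have dE : \det A * \det P / (\det B * \det Q)
  = (\det A / \det B) * (\det P / \det Q) by rewrite invfM mulrACA.
have trE : \tr (invmx (udu L A P) *m udu K B Q)
  = \tr (invmx A *m B) + \tr (invmx P *m Q)
    + \tr (invmx A *m ((K - L) *m Q *m (K - L)^T)).
  have iL : invmx (shear L) = shear (- L).
    apply: (can_inj (mulKmx (shear_unit L))).
    by rewrite mulmxV ?shear_unit // shearM subrr shear0.
  have bu : block_mx A 0 0 P \in unitmx.
    by rewrite unitmxE det_ublock unitrM -!unitmxE Au.
  have -> : invmx (udu L A P)
    = (shear (- L))^T *m block_mx (invmx A) 0 0 (invmx P) *m shear (- L).
    rewrite /udu invmxM ?unitmx_mul ?unitmx_tr ?shear_unit //.
    by rewrite invmxM ?shear_unit // -trmx_inv iL invmx_block_diag // !mulmxA.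
  have cycle (V G X : 'M[R]_(m + p)) :
    \tr (V^T *m G *m V *m X) = \tr (G *m (V *m X *m V^T)).
    by rewrite -!mulmxA mxtrace_mulC !mulmxA.
  have shearK : shear (- L) *m udu K B Q *m (shear (- L))^T = udu (K - L) B Q.
    by rewrite /udu !mulmxA shearM -mulmxA -trmx_mul shearM addrC.
  rewrite cycle shearK.
  rewrite uduE mulmx_block !mul0mx !addr0 mxtrace_block mulmxDr mxtraceD.
  by rewrite addrAC add0r.
rewrite /Idiv_real !det_udu dE lnM ?posrE ?divr_gt0 // trE natrD.
by field.
Qed.

Theorem proposition7p6 (R : realType) (n1 n2 k1 : nat)
  (hk : (k1 + n2 < n1 + n2)%N)
  (S : 'M[R]_(n1 + n2)) (hS : posdefmx S)
  (H : 'M[R]_(n1 + n2, k1 + n2)) (D : 'M[R]_(n1 + n2))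
  (hsol : FA_solution S (@singular_noise R n1 n2) H D)
  (D1 : 'M[R]_n1) (hD1 : posdiagmx D1) (hD : D = block_mx D1 0 0 0)
  (H11 : 'M[R]_(n1, k1)) (H12 : 'M[R]_(n1, n2)) (H22 : 'M[R]_n2)
  (hH22 : H22 \in unitmx) (hH : H = block_mx H11 H12 0 H22) :
  [/\ FA_solution (schur_compl S) (@posdiagmx R n1) H11 D1,
      H22 *m H22^T = drsubmx S
    & H12 = ursubmx S *m invmx (drsubmx S) *m H22].
Proof.
have Bpd := posdefmx_schur hS; have Qpd := posdefmx_drsubmx hS.
set K := ursubmx S *m invmx (drsubmx S).
pose mismatch (A : 'M[R]_n1) L :=
  2^-1 * \tr (invmx A *m ((K - L) *m drsubmx S *m (K - L)^T)).
have modelE (X : 'M[R]_(n1, k1)) (E : 'M[R]_n1) (L : 'M[R]_(n1, n2))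
    (G : 'M[R]_n2) :
  block_mx X (L *m G) 0 G *m (block_mx X (L *m G) 0 G)^T + block_mx E 0 0 0
  = udu L (X *m X^T + E) (G *m G^T).
  rewrite uduE tr_block_mx mulmx_block add_block_mx trmx0 !mulmx0 !mul0mx.
  by rewrite !add0r !addr0 trmx_mul !mulmxA addrAC.
have IdivE (X : 'M[R]_(n1, k1)) (E : 'M[R]_n1) (L : 'M[R]_(n1, n2))
    (G : 'M[R]_n2) : posdiagmx E -> posdefmx (G *m G^T) ->
  Idiv S (udu L (X *m X^T + E) (G *m G^T))
  = (Idiv_real (schur_compl S) (X *m X^T + E)
     + Idiv_real (drsubmx S) (G *m G^T) + mismatch (X *m X^T + E) L)%:E.
  move=> [_ Epd] Gpd; have Apd := posdefmx_gramD X Epd.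
  have Mu : udu L (X *m X^T + E) (G *m G^T) \in unitmx.
    by rewrite unitmxE det_udu unitrM -!unitmxE !posdefmx_unit.
  by rewrite Idiv_unitE // [in LHS](schur_udu hS) Idiv_real_udu.
have Ppd : posdefmx (H22 *m H22^T).
  rewrite -row_free_unit in hH22.
  by have := posdefmx_congr hH22 (posdefmx1 R n2); rewrite mulmx1.
have [T _ QT] := posdefmx_cholesky Qpd.
have QT' : drsubmx S = T^T *m T^T^T by rewrite trmxK.
(* H22 is invertible, so H12 is governed by its regression coefficient L. *)
pose L := H12 *m invmx H22.
have HE : H12 = L *m H22 by rewrite /L mulmxKV.
have [P0 Peq] := Idiv_real_ge0_eq0 Qpd Ppd.
have [_ D1pd] := hD1; have Apd := posdefmx_gramD H11 D1pd.
have [W0 Weq] := mxtrace_posdef_ge0_eq0 (K - L) Apd Qpd.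
have QQ : Idiv_real (drsubmx S) (drsubmx S) = 0.
  have Qu := posdefmx_unit Qpd; have Q0 := posdefmx_det_gt0 Qpd.
  by rewrite /Idiv_real divff ?gt_eqF // ln1 mulVmx // mxtrace1; field.
(* The competitor keeps X and E free, and takes T^T and K *m T^T in the last
   columns, which makes the last two terms of its divergence vanish. *)
have key (X : 'M[R]_(n1, k1)) (E : 'M[R]_n1) : posdiagmx E ->
  Idiv_real (schur_compl S) (H11 *m H11^T + D1)
  + Idiv_real (drsubmx S) (H22 *m H22^T) + mismatch (H11 *m H11^T + D1) L
  <= Idiv_real (schur_compl S) (X *m X^T + E).
  move=> Epd.
  have [_] := hsol.
  move=> /(_ (block_mx X (K *m T^T) 0 T^T) (block_mx E 0 0 0)).
  have -> : H = block_mx H11 (L *m H22) 0 H22 by rewrite -HE.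
  rewrite hD !modelE !IdivE // -?QT' // lee_fin QQ.
  rewrite {2}/mismatch subrr !mul0mx mulmx0 mxtrace0 mulr0 !addr0.
  by apply; exists E.
rewrite {}/mismatch in key IdivE.
split.
- split=> // X E Epd; have [_ Epd'] := Epd.
  rewrite !Idiv_unitE ?posdefmx_unit ?lee_fin //; try exact: posdefmx_gramD.
  by have := key X E Epd; lra.
(* Against its own (H11, D1), the excess of the solution must be zero. *)
- by apply: Peq; have := key H11 D1 hD1; lra.
- have /Weq/subr0_eq KL : \tr (invmx (H11 *m H11^T + D1)
      *m ((K - L) *m drsubmx S *m (K - L)^T)) = 0.
    by have := key H11 D1 hD1; lra.
  by rewrite KL.
Qed.
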